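(* Let $\mathsf{A}$ be a commutative unital real algebra, let $\{a_1,\dots,a_d\}$, $d\in\mathbb{N}_0$, be a set of generators of $\mathsf{A}$ as a unital real algebra, and let $K$ be a closed subset of $\hat{\mathsf{A}}$. Then the following statements are equivalent: (i) Each linear functional $L:\mathsf{A}\to\mathbb{R}$ is a general moment functional with representing signed measure supported by $K$. (ii) $K$ separates the points of $\mathsf{A}$ and the linear space $\mathcal{N}_n(K)$ is finite-dimensional for each $n\in\mathbb{N}_0$.
   Context: A character of $\mathsf{A}$ is an algebra homomorphism $\chi:\mathsf{A}\to\mathbb{R}$ with $\chi(1)=1$; $\hat{\mathsf{A}}$ denotes the set of characters. Each character $\chi$ is uniquely determined by the point $x_\chi=(\chi(a_1),\dots,\chi(a_d))\in\mathbb{R}^d$; one identifies $\chi$ with $x_\chi$ and writes $f(x):=\chi(f)$ for $f\in\mathsf{A}$ and $x=x_\chi$. Under this identification $\hat{\mathsf{A}}$ is a real algebraic (hence closed) subset of $\mathbb{R}^d$, and it carries the induced topology of $\mathbb{R}^d$, so it is a locally compact Hausdorff space and the elements of $\mathsf{A}$ are continuous functions on it. $M_+(\hat{\mathsf{A}})$ denotes the set of (positive) Radon measures $\mu$ on $\hat{\mathsf{A}}$ such that every $f\in\mathsf{A}$ is $\mu$-integrable (all such measures are finite since $1\in\mathsf{A}$). A linear functional $L$ on $\mathsf{A}$ is a general moment functional if there are $\mu_1,\mu_2\in M_+(\hat{\mathsf{A}})$ with $$L(f)=\int f(x)\,d\mu_1(x)-\int f(x)\,d\mu_2(x)\quad\text{for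 all } f\in\mathsf{A};$$ then $\mu=\mu_1-\mu_2$ is called a representing signed measure of $L$. It is supported by $K$ if $\mathrm{supp}\,\mu_1\subseteq K$ and $\mathrm{supp}\,\mu_2\subseteq K$. $K$ separates the points of $\mathsf{A}$ if, for $a\in\mathsf{A}$, $a(x)=0$ for all $x\in K$ implies $a=0$. For $n\in\mathbb{N}_0$, $\mathcal{N}_n(K)$ is the real linear subspace of all $a\in\mathsf{A}$ for which there exists a number $C_a>0$ such that $|a(x)|\le C_a(1+a_1(x)^2+\cdots+a_d(x)^2)^n$ for all $x\in K$. *)

(* Defs.v *)
From HB Require Import structures.
From mathcomp Require Import all_boot all_order all_algebra.
From mathcomp Require Import all_classical all_reals all_analysis.
Import Order.TTheory GRing.Theory Num.Theory.
Import numFieldNormedType.Exports.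

Set Implicit Arguments.
Unset Strict Implicit.
Unset Printing Implicit Defensive.

Local Open Scope classical_set_scope.
Local Open Scope ring_scope.

Definition borel (R : realType) (d : nat) :=
  g_sigma_algebraType (@open 'rV[R]_d).

Section Characters.
Context {R : realType} {A : comAlgType R} {d : nat}.

Definition generates (a : 'I_d -> A) : Prop :=
  forall S : {pred A}, subalg_closed S -> (forall i, a i \in S) ->
  forall f, f \in S.

Definition char_point (a : 'I_d -> A) (chi : {lrmorphism A -> R | *%R}) :
    'rV[R]_d :=
  \row_i chi (a i).

Definition char_space (a : 'I_d -> A) : set 'rV[R]_d := range (char_point a).

(* f(x) := chi(f) where x = x_chi; the value is unique when a generates A
   (char_evalE), and it is 0 by convention outside the character space. *)
Definition char_eval (a : 'I_d -> A) (f : A) (x : 'rV[R]_d) : R :=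
  xget 0 [set chi f | chi in char_point a @^-1` [set x]].

(* A measurableType is nonempty, whereas the character space may be empty.
   Measures on this closed subset X of R^d (closed_char_space) are encoded as Borel
   measures on R^d for which the complement of X is null. *)
Definition radon_on (X : set 'rV[R]_d) (mu : {measure set (borel R d) -> \bar R})
    : Prop :=
  [/\ mu (~` X) = 0%E,
      forall C : set 'rV[R]_d, compact C -> C `<=` X -> (mu C < +oo)%E
    & forall B : set (borel R d), measurable B -> B `<=` X ->
        mu B = ereal_sup
          [set mu C | C in [set C : set 'rV[R]_d | compact C /\ C `<=` B]]].

Definition moment_measure (a : 'I_d -> A)
    (mu : {measure set (borel R d) -> \bar R}) : Prop :=
  radon_on (char_space a) mu /\
  forall f : A, mu.-integrable (char_space a) (EFin \o char_eval a f).

(* The smallest relatively closed subset of X whose complement in X is null. *)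
Definition support_in (X : set 'rV[R]_d)
    (mu : {measure set (borel R d) -> \bar R}) : set 'rV[R]_d :=
  X `&` \bigcap_(C in [set C | closed C /\ mu (X `\` C) = 0%E]) C.

Definition general_moment_functional_on (a : 'I_d -> A) (K : set 'rV[R]_d)
    (L : {scalar A}) : Prop :=
  exists mu1 mu2 : {measure set (borel R d) -> \bar R},
    [/\ moment_measure a mu1, moment_measure a mu2,
        support_in (char_space a) mu1 `<=` K,
        support_in (char_space a) mu2 `<=` K
      & forall f : A,
          L f = \int[mu1]_(x in char_space a) char_eval a f x
              - \int[mu2]_(x in char_space a) char_eval a f x].

Definition separates_points (a : 'I_d -> A) (K : set 'rV[R]_d) : Prop :=
  forall f : A, (forall x, K x -> char_eval a f x = 0) -> f = 0.

Definition growth_space (a : 'I_d -> A) (K : set 'rV[R]_d) (n : nat) : set A :=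
  [set f | exists2 C : R, 0 < C & forall x, K x ->
     `|char_eval a f x| <= C * (1 + \sum_(i < d) char_eval a (a i) x ^+ 2) ^+ n].

Definition finite_dimensional (V : set A) : Prop :=
  exists (m : nat) (b : 'I_m -> A),
    V = range (fun c : 'I_m -> R => \sum_(i < m) c i *: b i).

Lemma charP (chi : {lrmorphism A -> R | *%R}) k (u v : A) :
  chi (k *: u + v) = k * chi u + chi v.
Proof. exact: (scalarP chi). Qed.

Lemma charM (chi : {lrmorphism A -> R | *%R}) (u v : A) :
  chi (u * v) = chi u * chi v.
Proof. exact: (rmorphM chi). Qed.

Lemma char_point_inj (a : 'I_d -> A) (chi psi : {lrmorphism A -> R | *%R}) :
  generates a -> char_point a chi = char_point a psi -> chi =1 psi.
Proof.
move=> gen e f; apply/eqP.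
have := gen [pred g | chi g == psi g]; apply.
  split=> [|k u v|u v]; rewrite !inE; first by rewrite !rmorph1.
    by move=> /eqP eu /eqP ev; rewrite !charP eu ev.
  by move=> /eqP eu /eqP ev; rewrite !charM eu ev.
by move=> i; rewrite inE; have /rowP/(_ i) := e; rewrite !mxE => ->.
Qed.

Lemma char_evalE (a : 'I_d -> A) (chi : {lrmorphism A -> R | *%R}) (f : A) :
  generates a -> char_eval a f (char_point a chi) = chi f.
Proof.
move=> gen; rewrite /char_eval; case: xgetP => [_ _ [psi e <-]|/(_ (chi f))].
  exact: char_point_inj gen e f.
by case; exists chi.
Qed.

Lemma closed_char_space (a : 'I_d -> A) : generates a -> closed (char_space a).
Proof.
move=> gen x clx; pose V : topologicalType := 'rV[R]_d.
have cst_c (k : R) : continuous (fun _ : V => k).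
  by move=> y; exact: (@cst_continuous V R k y).
have add_c (g h : V -> R) : continuous g -> continuous h ->
    continuous (fun y => g y + h y).
  by move=> cg ch y; exact: (cvgD (cg y) (ch y)).
have mul_c (g h : V -> R) : continuous g -> continuous h ->
    continuous (fun y => g y * h y).
  by move=> cg ch y; exact: (cvgM (cg y) (ch y)).
have sub_c (g h : V -> R) : continuous g -> continuous h ->
    continuous (fun y => g y - h y).
  by move=> cg ch y; exact: (cvgB (cg y) (ch y)).
have coord_c i : continuous (fun y : V => (y : 'rV[R]_d) 0 i).
  exact: (@coord_continuous R 1 d 0 i).
have rep f : exists g : V -> R,
    continuous g /\ forall chi, g (char_point a chi) = chi f.
  pose P (f : A) := exists g : V -> R,
    continuous g /\ forall chi, g (char_point a chi) = chi f.
  suff : f \in [pred f | `[< P f >]] by move/asboolP.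
  apply: gen => [|i]; last first.
    apply/asboolP; exists (fun y : 'rV[R]_d => y 0 i).
    split=> [|chi]; [exact: coord_c | by rewrite mxE].
  split=> [|k u v|u v].
  - apply/asboolP; exists (fun=> 1).
    split=> [|chi]; [exact: cst_c | by rewrite rmorph1].
  - move=> /asboolP[g [cg eg]] /asboolP[h [ch eh]]; apply/asboolP.
    exists (fun y => k * g y + h y); split=> [|chi].
      by apply: add_c => //; exact: mul_c.
    by rewrite charP eg eh.
  - move=> /asboolP[g [cg eg]] /asboolP[h [ch eh]]; apply/asboolP.
    exists (fun y => g y * h y); split=> [|chi].
      exact: mul_c.
    by rewrite charM eg eh.
have [g /all_and2 [cg eg]] := choice rep.
have ext (h : V -> R) : continuous h ->
    (forall chi, h (char_point a chi) = 0) -> h x = 0.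
  move=> ch h0; have : closed (h @^-1` [set 0]).
    by move/continuous_closedP: ch; apply; exact: closed_eq.
  by apply=> B /clx [_ [[chi _ <-] By]]; exists (char_point a chi); split=> //=.
pose phi f := g f x.
have phiP k u v : phi (k *: u + v) = k * phi u + phi v.
  apply/eqP; rewrite -subr_eq0; apply/eqP.
  apply: (ext (fun y => g (k *: u + v) y - (k * g u y + g v y))) => [|chi].
    by apply: sub_c => //; apply: add_c => //; exact: mul_c.
  by rewrite !eg charP subrr.
have phiM u v : phi (u * v) = phi u * phi v.
  apply/eqP; rewrite -subr_eq0; apply/eqP.
  apply: (ext (fun y => g (u * v) y - g u y * g v y)) => [|chi].
    by apply: sub_c => //; exact: mul_c.
  by rewrite !eg charM subrr.
have phi1 : phi 1 = 1.
  apply/eqP; rewrite -subr_eq0; apply/eqP.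
  apply: (ext (fun y => g 1 y - 1)) => [|chi].
    exact: sub_c.
  by rewrite eg rmorph1 subrr.
have phi_scalar : scalar phi by move=> k u v; exact: phiP.
pose linM := GRing.isLinear.Build R A R *%R phi phi_scalar.
pose mulM := GRing.isMonoidMorphism.Build A R phi (conj phi1 phiM).
pose chi : {lrmorphism A -> R | *%R} := HB.pack phi linM mulM.
exists chi => //; apply/rowP => i; rewrite mxE /= /phi.
apply/eqP; rewrite -subr_eq0; apply/eqP.
apply: (ext (fun y => g (a i) y - (y : 'rV[R]_d) 0 i)) => [|psi].
  exact: sub_c.
by rewrite eg mxE subrr.
Qed.

End Characters.

(* Main.v *)
Require Import Defs.
From HB Require Import structures.
From mathcomp Require Import all_boot all_order all_algebra finmap.
From mathcomp Require Import all_classical all_reals all_analysis.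
From mathcomp Require Import measurable_realfun.
From mathcomp Require Import ring lra.
Import Order.TTheory GRing.Theory Num.Theory.
Import numFieldNormedType.Exports.

Local Open Scope classical_set_scope.
Local Open Scope ring_scope.

(** The theorem compares two ways of controlling a linear functional by its
    values on [K].  Write [p = 1 + a_1^2 + ... + a_d^2] for the weight and [N_n]
    for the elements of [A] that are [O(p^n)] on [K].  As [A] is generated by
    the [a_i], the [N_n] exhaust [A].

    From moments to finite dimension.  If [L] is represented by
    [mu1 - mu2] and both measures live on [K], then [|f| <= C p^n] on [K] forces
    [|L f| <= C M], where [M] is the sum of the two moments of [p^n]
    ([functional_growth_bound]).  So every linear functional on [A] is bounded
    for the weighted sup-norm of [N_n].  With [C = 0] this gives separation,
    since a nonzero element is seen by some functional.  If [N_n] were infinite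
    dimensional it would contain an independent sequence [f_k], with
    [|f_k| <= C_k p^n] on [K], and a functional with [L f_k = k C_k] would be
    unbounded.  That the measures are carried by [K], and not just supported in
    it, comes from inner regularity ([radon_null_off_support]).

    From finite dimension to moments.  The representing measures are
    countable sums of point masses in [K], built in finite blocks [s_0, s_1, ...]
    so that after block [n] the functional [L] is represented exactly on [N_n].
    The error left on [N_(n+1)] vanishes on [N_n], and the point is that block
    [n+1] can then be chosen with arbitrarily small mass against the weight
    [p^n] ([small_atomic_representation]): otherwise Hahn-Banach on the dual of
    the finite-dimensional space [N_(n+1)] produces an element [f] of [N_(n+1)] with
    [|f| <= p^n] on [K] on which the error is positive; but such an [f] lies in
    [N_n].  Taking the mass of block [n+1] against [p^n] below [2^-(n+1)], all
    elements of [A] become absolutely summable against the point masses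
    ([atomic_blocks_summable]), and splitting the masses by sign gives [mu1] and
    [mu2].  The first block uses separation in place of smallness: the weight
    is [0] there, and only [f = 0] satisfies [|f| <= 0] on [K]. *)

(** * Dominated extension of linear functionals *)

Section DominatedExtension.
Context {R : realType} {V : lmodType R}.
Implicit Types (Q G : V -> R -> Prop) (u v y : V) (r s x z : R).

(** A partially defined linear functional, as the subspace of [V * R] that is
    its graph.  Functionality is not part of it: it follows from domination by
    a cone containing [(0, 0)]. *)
Definition linear_graph G :=
  G 0 0 /\ forall k u v x z, G u x -> G v z -> G (k *: u + v) (k * x + z).

Definition dominated_by Q G := forall u x r, G u x -> Q u r -> x <= r.

(** [Q u r] reads: the functional to be found must satisfy [L u <= r].  Stating
    the constraints as a relation, and not as a sublinear function, allows
    vectors without any bound.  The last clause asks that bounded directions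
    come in opposite pairs: in an extension step, the new value then has both
    upper and lower bounds, or neither. *)
Definition bounding_cone Q :=
  [/\ Q 0 0, forall u v r s, Q u r -> Q v s -> Q (u + v) (r + s),
      forall k u r, 0 < k -> Q u r -> Q (k *: u) (k * r)
    & forall u r, Q u r -> exists s, Q (- u) s].

Definition extend_graph G y z : V -> R -> Prop :=
  fun v r => exists k u x, [/\ G u x, v = u + k *: y & r = x + k * z].

Lemma linear_graphN G u x : linear_graph G -> G u x -> G (- u) (- x).
Proof.
case=> G0 Gl Gu; have := Gl (-1) _ _ _ _ Gu G0.
by rewrite scaleN1r addr0 mulN1r addr0.
Qed.

Lemma linear_extend_graph G y z :
  linear_graph G -> linear_graph (extend_graph G y z).
Proof.
move=> [G0 Gl]; split; first by exists 0, 0, 0; rewrite scale0r mul0r !addr0.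
move=> c _ _ _ _ [k1 [u1 [x1 [G1 -> ->]]]] [k2 [u2 [x2 [G2 -> ->]]]].
exists (c * k1 + k2), (c *: u1 + u2), (c * x1 + x2); split; first exact: Gl.
  by rewrite scalerDl scalerDr scalerA addrACA.
by ring.
Qed.

(** Domination of the extension with value [z] at [y] means that [z] lies above
    every [x - r] with [Q (u - y) r] and below every [r - x] with [Q (u + y) r],
    for [x] the value at [u].  Adding a constraint of each kind shows
    that these bounds are compatible, so the supremum of the lower ones will do.
    When there are no lower bounds there are no upper ones either, and the
    default value of [sup] on the empty set is as good as any other. *)
Lemma dominated_extend_graph Q G y :
  bounding_cone Q -> linear_graph G -> dominated_by Q G ->
  exists z, dominated_by Q (extend_graph G y z).
Proof.
move=> [Q0 Qa Qs QN] Glin GQ; have [G0 Gl] := Glin.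
pose Lo : set R := [set t | exists u x r, [/\ G u x, Q (u - y) r & t = x - r]].
have GD u v x z : G u x -> G v z -> G (u + v) (x + z).
  by move=> Gu Gv; rewrite -[u]scale1r -[x]mul1r; exact: Gl.
have GZ k u x : G u x -> G (k *: u) (k * x).
  by move=> Gu; rewrite -[_ *: u]addr0 -[_ * x]addr0; exact: Gl.
have LoUp t u x r : Lo t -> G u x -> Q (u + y) r -> t <= r - x.
  move=> [u' [x' [r' [Gu' Qu' ->]]]] Gu Qu.
  have := GQ _ _ _ (GD _ _ _ _ Gu' Gu); move/(_ (r' + r)).
  rewrite -[u' + u](_ : u' - y + (u + y) = _); last by rewrite addrACA addNr addr0.
  by move=> /(_ (Qa _ _ _ _ Qu' Qu)); lra.
exists (sup Lo) => _ _ r [k [u [x [Gu -> ->]]]] Qr.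
have [k0|k0|k0] := ltgtP k 0; last first.
- by move: Qr; rewrite k0 scale0r mul0r !addr0; exact: GQ Gu.
- have Qk : Q (k^-1 *: u + y) (k^-1 * r).
    have := Qs k^-1 _ _ _ Qr; rewrite invr_gt0 => /(_ k0).
    by rewrite scalerDr scalerA mulVf ?gt_eqF// scale1r.
  suff : sup Lo <= k^-1 * r - k^-1 * x.
    by rewrite -mulrBr ler_pdivlMl//; lra.
  apply: ge_sup; last first.
    by move=> t Lot; apply: LoUp Lot _ Qk; exact: GZ.
  have [s Qs'] := QN _ _ Qk.
  exists (- (k^-1 * x) - s), (- (k^-1 *: u)), (- (k^-1 * x)), s.
  by split=> //; [exact: linear_graphN Glin (GZ _ _ _ Gu) | rewrite -opprD].
- have k0' : 0 < - k by rewrite oppr_gt0.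
  have Qk : Q ((- k)^-1 *: u - y) ((- k)^-1 * r).
    have := Qs (- k)^-1 _ _ _ Qr; rewrite invr_gt0 => /(_ k0').
    rewrite scalerDr scalerA invrN mulNr mulVf ?lt_eqF// scaleN1r.
    by rewrite -invrN.
  suff : (- k)^-1 * x - (- k)^-1 * r <= sup Lo.
    by rewrite -mulrBr ler_pdivrMl//; lra.
  apply: ub_le_sup; last first.
    by exists ((- k)^-1 *: u), ((- k)^-1 * x), ((- k)^-1 * r); split=> //; exact: GZ.
  have [s Qs'] := QN _ _ Qk.
  exists (s - - ((- k)^-1 * x)) => t Lot.
  apply: (LoUp _ (- ((- k)^-1 *: u))) => //; first exact: linear_graphN Glin (GZ _ _ _ Gu).
  by move: Qs'; rewrite opprB addrC.
Qed.

(** The Hahn-Banach theorem, by Zorn's lemma applied to the graphs containing [G].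
    Two opposite instances are needed: bounds in all directions spanned by the
    points of [K], and no bounds at all ([linear_extension]). *)
Lemma dominated_extension Q G :
  bounding_cone Q -> linear_graph G -> dominated_by Q G ->
  exists L : {scalar V},
    (forall u x, G u x -> L u = x) /\ (forall u r, Q u r -> L u <= r).
Proof.
move=> Qc Glin GQ.
(* Zorn's lemma ranges over the part [S] added to [G], so that the empty chain,
   whose union is empty, is harmless. *)
pose gr (S : set (V * R)) u x := G u x \/ S (u, x).
pose P (S : set (V * R)) := linear_graph (gr S) /\ dominated_by Q (gr S).
have [|S [[Slin SQ] Smax]] := @Zorn_bigcup _ P.
  move=> F FP Ftot.
  have pairF u v x z : gr (\bigcup_(X in F) X) u x -> gr (\bigcup_(X in F) X) v z ->
      exists2 X, P X & [/\ gr X u x, gr X v z & X `<=` \bigcup_(X in F) X].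
    have P0 : P set0.
      have -> // : P set0 = (linear_graph G /\ dominated_by Q G).
      rewrite /P (_ : gr set0 = G)//; apply/funext => u'; apply/funext => x'.
      by rewrite /gr; apply/propext; split=> [[]|]//; left.
    move=> [Gu|[X FX Xu]] [Gv|[Y FY Yv]].
    - by exists set0 => //; split=> //; left.
    - by exists Y; [exact: FP|split; [left|right|exact: bigcup_sup]].
    - by exists X; [exact: FP|split; [right|left|exact: bigcup_sup]].
    - have [XY|YX] := Ftot _ _ FX FY.
        by exists Y; [exact: FP|split; [right; exact: XY|right|exact: bigcup_sup]].
      by exists X; [exact: FP|split; [right|right; exact: YX|exact: bigcup_sup]].
  split; first split.
  - by left; case: Glin.
  - move=> k u v x z Hu Hv; have [X [[_ Xl] _] [Xu Xv XF]] := pairF _ _ _ _ Hu Hv.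
    by have [?|/XF ?] := Xl k _ _ _ _ Xu Xv; [left|right].
  - move=> u x r Hu; have [X [_ XQ] [Xu _ _]] := pairF _ _ _ _ Hu Hu.
    exact: XQ Xu.
have S0 : gr S 0 0 by case: Slin.
have Sfun u x z : gr S u x -> gr S u z -> x = z.
  have [Q0 _ _ _] := Qc; have [_ Sl] := Slin.
  suff le x' z' : gr S u x' -> gr S u z' -> x' <= z'.
    by move=> ux uz; apply/eqP; rewrite eq_le !le.
  move=> ux uz; have := Sl (-1) _ _ _ _ uz ux.
  rewrite scaleN1r addNr mulN1r => /SQ/(_ Q0); lra.
have Stot y : exists x, gr S y x.
  apply: contrapT => /forallNP ny.
  have [z zQ] := dominated_extend_graph _ _ y Qc Slin SQ.
  pose T : set (V * R) := [set p | extend_graph (gr S) y z p.1 p.2].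
  have SE u x : gr S u x -> extend_graph (gr S) y z u x.
    by move=> Su; exists 0, u, x; rewrite scale0r mul0r !addr0.
  have grT : gr T = extend_graph (gr S) y z.
    apply/funext => u; apply/funext => x; apply/propext; split.
      by move=> [Gu|//]; apply: SE; left.
    by right.
  apply: (Smax T); last first.
    by rewrite /P grT; split=> //; exact: linear_extend_graph.
  split=> [[u x] Su|TS]; first by apply: SE; right.
  apply: (ny z); right; apply: TS; exists 1, 0, 0.
  by rewrite scale1r mul1r !add0r.
have [f fS] := choice Stot.
have f_scalar : scalar f.
  move=> k u v; apply: (Sfun (k *: u + v)) => //.
  by case: Slin => _; apply.
pose L : {scalar V} := HB.pack f (GRing.isLinear.Build R V R *%R f f_scalar).
exists L; split=> [u x Gu|u r]; first by apply: (Sfun u) => //; left.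
exact: SQ.
Qed.

(** The purely algebraic case, where the only constraint is [L 0 <= 0]. *)
Lemma linear_extension G :
  linear_graph G -> (forall x, G 0 x -> x = 0) ->
  exists L : {scalar V}, forall u x, G u x -> L u = x.
Proof.
move=> Glin G0.
pose Q u r := u = 0 /\ 0 <= r.
have [||L [LG _]] := @dominated_extension Q G _ Glin.
- split=> //.
  + by move=> u v r s [-> r0] [-> s0]; split; [rewrite addr0|exact: addr_ge0].
  + by move=> k u r k0 [-> r0]; split; [rewrite scaler0|rewrite mulr_ge0// ltW].
  + by move=> u r [-> _]; exists 0; split; rewrite ?oppr0.
- by move=> u x r /[swap] -[-> r0] /G0 ->.
by exists L.
Qed.

End DominatedExtension.

(** * Small atomic representations in finite dimension *)

Section FiniteDimensionalDuality.
Context {R : realType} {V : lmodType R}.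

Lemma scalar_sum (g : V -> R) m (c : 'I_m -> R) (b : 'I_m -> V) :
  scalar g -> g (\sum_(i < m) c i *: b i) = \sum_(i < m) c i * g (b i).
Proof.
move=> g_lin.
pose h : {scalar V} := HB.pack g (GRing.isLinear.Build R V R *%R g g_lin).
by rewrite -[g]/(h : V -> R) linear_sum; apply: eq_bigr => i _; rewrite scalarZ.
Qed.

Lemma rV_functionalE m (L : {scalar 'rV[R]_m}) v :
  L v = \sum_(i < m) v 0 i * L (delta_mx 0 i).
Proof.
rewrite [in LHS](row_sum_delta v) linear_sum.
by apply: eq_bigr => i _; rewrite scalarZ.
Qed.

(** The heart of the matter.  A functional [l] on the span of [b] is identified
    with the vector [t] of its values on [b], and [Q v r] says that [v] is
    represented by point masses in [K] of total mass at most [r] against [w].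
    If [Q t eps] fails, the functional [k *: t |-> k * eps] on the line through
    [t] is dominated by [Q]; its extension [L] is evaluation at the element
    [f] with coefficients [L (delta_mx 0 i)].  Applied to single point masses, the
    domination says that [|ev x f| <= w x] on [K], so [l f = 0], whereas
    [l f = L t = eps]. *)
Lemma small_atomic_representation (T : eqType) (K : set T) (ev : T -> V -> R)
    m (b : 'I_m -> V) (w : T -> R) (l : V -> R) (eps : R) :
  (forall x, K x -> scalar (ev x)) -> scalar l ->
  (forall x, K x -> 0 <= w x) -> 0 < eps ->
  (forall c : 'I_m -> R, let f := \sum_(i < m) c i *: b i in
     (forall x, K x -> `|ev x f| <= w x) -> l f = 0) ->
  exists s : seq (R * T),
    [/\ forall p, p \in s -> K p.2,
        forall c : 'I_m -> R, let f := \sum_(i < m) c i *: b i in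
          \sum_(p <- s) p.1 * ev p.2 f = l f
      & \sum_(p <- s) `|p.1| * w p.2 <= eps].
Proof.
move=> ev_lin l_lin w0 eps0 l0.
pose Q (v : 'rV[R]_m) r := exists s : seq (R * T),
  [/\ forall p, p \in s -> K p.2,
      forall i, v 0 i = \sum_(p <- s) p.1 * ev p.2 (b i)
    & \sum_(p <- s) `|p.1| * w p.2 <= r].
pose t : 'rV[R]_m := \row_i l (b i).
suff [s [sK st sw]] : Q t eps.
  exists s; split=> // c f; rewrite scalar_sum//.
  under [RHS]eq_bigr => i _.
    have := st i; rewrite mxE => ->; rewrite mulr_sumr; over.
  rewrite exchange_big/=; apply: eq_big_seq => p /sK Kp.
  rewrite scalar_sum ?mulr_sumr; last exact: ev_lin.
  by apply: eq_bigr => i _; rewrite mulrCA.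
have Q_ge0 v r : Q v r -> 0 <= r.
  move=> [s [sK _]]; apply: le_trans; rewrite big_seq sumr_ge0// => p /sK Kp.
  by rewrite mulr_ge0// w0.
have QZ k v r : Q v r -> Q (k *: v) (`|k| * r).
  move=> [s [sK sv sr]]; exists [seq (k * p.1, p.2) | p <- s]; split.
  - by move=> _ /mapP[p /sK Kp ->].
  - move=> i; rewrite mxE sv big_map mulr_sumr.
    by apply: eq_bigr => p _; rewrite mulrA.
  - rewrite big_map/= (le_trans _ (ler_wpM2l (normr_ge0 k) sr))// mulr_sumr.
    by apply: ler_sum => p _; rewrite normrM mulrA.
apply: contrapT => nQt.
pose G (v : 'rV[R]_m) r := exists k, v = k *: t /\ r = k * eps.
have [||v r s [k [-> ->]] Qv|L [LG LQ]] := @dominated_extension _ _ Q G.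
- split.
  + by exists [::]; split=> // [i|]; rewrite big_nil// mxE.
  + move=> u v r s [su [suK suv sur]] [sv [svK svv svr]].
    exists (su ++ sv); split.
    * by move=> p; rewrite mem_cat => /orP[/suK|/svK].
    * by move=> i; rewrite mxE suv svv big_cat.
    * by rewrite big_cat/= lerD.
  + by move=> k u r k0 /(QZ k); rewrite gtr0_norm.
  + by move=> u r /(QZ (-1)); rewrite scaleN1r; exists (`|-1| * r).
- split; first by exists 0; rewrite scale0r mul0r.
  move=> k _ _ _ _ [k1 [-> ->]] [k2 [-> ->]]; exists (k * k1 + k2); split.
    by rewrite scalerDl scalerA.
  by ring.
- have [k0|k0] := leP k 0.
    by rewrite (le_trans _ (Q_ge0 _ _ Qv))// mulr_le0_ge0// ltW.
  rewrite leNgt; apply/negP => sk; apply: nQt.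
  have [s' [s'K s't s'e]] := QZ k^-1 _ _ Qv.
  exists s'; split=> //.
    by move=> i; rewrite -s't scalerA mulVf ?gt_eqF// scale1r.
  apply: le_trans s'e _.
  by rewrite gtr0_norm ?invr_gt0// mulrC ler_pdivrMr// mulrC ltW.
pose f := \sum_(i < m) L (delta_mx 0 i) *: b i.
suff : l f = 0.
  rewrite /f scalar_sum//.
  have -> : \sum_(i < m) L (delta_mx 0 i) * l (b i) = L t.
    by rewrite rV_functionalE; apply: eq_bigr => i _; rewrite mxE mulrC.
  rewrite (LG t eps); last by exists 1; rewrite scale1r mul1r.
  by move=> e0; rewrite e0 ltxx in eps0.
apply: l0 => x Kx; pose e : 'rV[R]_m := \row_i ev x (b i).
have Qe : Q e (w x).
  exists [:: (1, x)]; split; first by move=> p; rewrite inE => /eqP ->.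
    by move=> i; rewrite big_seq1 mxE mul1r.
  by rewrite big_seq1 normr1 mul1r.
have -> : ev x (\sum_(i < m) L (delta_mx 0 i) *: b i) = L e.
  rewrite scalar_sum; last exact: ev_lin.
  by rewrite rV_functionalE; apply: eq_bigr => i _; rewrite mxE mulrC.
rewrite ler_norml LQ// andbT lerNl -mulN1r -scalarZ.
by have /LQ := QZ (-1) _ _ Qe; rewrite normrN1 mul1r.
Qed.

End FiniteDimensionalDuality.

(** * The character space and growth on it *)

Section CharacterSpace.
Context {R : realType} {A : comAlgType R} {d : nat} (a : 'I_d -> A).
Hypothesis a_gen : generates a.
Implicit Types (x : 'rV[R]_d) (f g : A).

Local Notation X := (char_space a).

Lemma char_space_eval x :
  X x -> exists chi : {lrmorphism A -> R | *%R}, forall f, char_eval a f x = chi f.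
Proof. by move=> [chi _ <-]; exists chi => f; exact: char_evalE. Qed.

Lemma char_eval_scalar x : X x -> scalar (char_eval a ^~ x).
Proof. by move=> /char_space_eval[chi chiE] k f g; rewrite !chiE charP. Qed.

Lemma char_evalM f g x :
  X x -> char_eval a (f * g) x = char_eval a f x * char_eval a g x.
Proof. by move=> /char_space_eval[chi chiE]; rewrite !chiE charM. Qed.

Lemma char_eval1 x : X x -> char_eval a 1 x = 1.
Proof. by move=> /char_space_eval[chi chiE]; rewrite chiE rmorph1. Qed.

Lemma char_eval_gen i x : X x -> char_eval a (a i) x = x 0 i.
Proof. by move=> [chi _ <-]; rewrite char_evalE// mxE. Qed.

Definition weight : A := 1 + \sum_(i < d) a i ^+ 2.

Lemma char_eval_weight n x : X x ->
  char_eval a (weight ^+ n) x = (1 + \sum_(i < d) char_eval a (a i) x ^+ 2) ^+ n.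
Proof.
move=> /char_space_eval[chi chiE]; rewrite chiE rmorphXn rmorphD rmorph1 rmorph_sum.
by congr ((1 + _) ^+ n); apply: eq_bigr => i _; rewrite rmorphXn chiE.
Qed.

Lemma char_eval_weight_ge1 n x : X x -> 1 <= char_eval a (weight ^+ n) x.
Proof.
by move=> Xx; rewrite char_eval_weight// exprn_ege1// lerDl sumr_ge0// => i _; exact: sqr_ge0.
Qed.

Lemma char_eval_weight_mono m n x : (m <= n)%N -> X x ->
  char_eval a (weight ^+ m) x <= char_eval a (weight ^+ n) x.
Proof.
move=> mn Xx; rewrite -(subnK mn) exprD char_evalM// ler_peMl//.
  exact: le_trans (char_eval_weight_ge1 _ _ Xx).
exact: char_eval_weight_ge1.
Qed.

Section Growth.
Variable K : set 'rV[R]_d.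
Hypothesis KX : K `<=` X.

(** Allowing any real constant and moving the weight into the algebra makes the
    growth condition stable under linear combinations and comparable with
    moments of the single element [weight ^+ n]. *)
Lemma growth_spaceP n f : growth_space a K n f <->
  exists C, forall x, K x ->
    `|char_eval a f x| <= C * char_eval a (weight ^+ n) x.
Proof.
split=> [[C _ Cf]|[C Cf]].
  by exists C => x Kx; rewrite char_eval_weight ?Cf//; exact: KX.
exists (`|C| + 1) => [|x Kx]; first by rewrite ltr_wpDl.
rewrite -char_eval_weight; last exact: KX.
rewrite (le_trans (Cf _ Kx))// ler_wpM2r//.
  exact/(le_trans ler01)/char_eval_weight_ge1/KX.
by rewrite (le_trans (ler_norm C))// lerDl.
Qed.

Lemma growth_space_lin n k f g : growth_space a K n f -> growth_space a K n g ->
  growth_space a K n (k *: f + g).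
Proof.
move=> /growth_spaceP[C Cf] /growth_spaceP[D Dg]; apply/growth_spaceP.
exists (`|k| * C + D) => x Kx; rewrite char_eval_scalar; last exact: KX.
rewrite (le_trans (ler_normD _ _))// mulrDl lerD ?Dg//.
by rewrite normrM -mulrA ler_wpM2l// Cf.
Qed.

Lemma growth_space0 n : growth_space a K n 0.
Proof.
apply/growth_spaceP; exists 0 => x /KX /char_space_eval[chi chiE].
by rewrite chiE rmorph0 normr0 mul0r.
Qed.

Lemma growth_space_mono m n f :
  (m <= n)%N -> growth_space a K m f -> growth_space a K n f.
Proof.
move=> mn [C C0 Cf]; apply/growth_spaceP; exists C => x Kx.
rewrite (le_trans (Cf _ Kx))// ler_pM2l// -char_eval_weight; last exact: KX.
by apply: char_eval_weight_mono => //; exact: KX.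
Qed.

Lemma growth_space_exhaust f : exists n, growth_space a K n f.
Proof.
pose P f := exists n, growth_space a K n f.
suff : f \in [pred f | `[< P f >]] by move/asboolP.
apply: a_gen => [|i]; [split=> [|k u v|u v]|].
- apply/asboolP; exists 0; apply/growth_spaceP; exists 1 => x /KX Kx.
  by rewrite expr0 mul1r ger0_norm char_eval1.
- move=> /asboolP[m um] /asboolP[n vn]; apply/asboolP; exists (maxn m n).
  apply: growth_space_lin; [move: um|move: vn]; apply: growth_space_mono.
    exact: leq_maxl.
  exact: leq_maxr.
- move=> /asboolP[m [C C0 uC]] /asboolP[n [D D0 vD]].
  apply/asboolP; exists (m + n)%N, (C * D) => [|x Kx]; first exact: mulr_gt0.
  rewrite char_evalM; last exact: KX.
  by rewrite normrM exprD mulrACA ler_pM// ?uC ?vD.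
- apply/asboolP; exists 1; apply/growth_spaceP; exists 1 => x Kx.
  rewrite mul1r char_eval_weight ?expr1; last exact: KX.
  set y := char_eval a (a i) x.
  (* The weight dominates each generator: [|y| <= 1 + y^2]. *)
  have y1 : `|y| <= 1 + y ^+ 2.
    by rewrite -(real_normK (num_real y)); nra.
  apply: (le_trans y1); rewrite lerD2l (bigD1 i)//= lerDl.
  by apply: sumr_ge0 => j _; exact: sqr_ge0.
Qed.

End Growth.

Lemma measurable_closed (C : set 'rV[R]_d) : closed C -> measurable (C : set (borel R d)).
Proof.
move=> C_closed; rewrite -[C]setCK; apply: measurableC.
by apply: sub_sigma_algebra; exact: closed_openC.
Qed.

Lemma measurable_char_space : measurable (X : set (borel R d)).
Proof. by apply: measurable_closed; exact: closed_char_space. Qed.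

Lemma measurable_char_eval f : measurable_fun (X : set (borel R d)) (char_eval a f).
Proof.
have mX := measurable_char_space.
pose P f := measurable_fun (X : set (borel R d)) (char_eval a f).
suff : f \in [pred f | `[< P f >]] by move/asboolP.
apply: a_gen => [|i]; [split=> [|k u v|u v]|].
- apply/asboolP; apply: (@eq_measurable_fun _ _ (borel R d) R X (cst 1)) => [x|].
    by move=> /set_mem Xx; rewrite char_eval1.
  exact: measurable_cst.
- move=> /asboolP mu /asboolP mv; apply/asboolP.
  apply: (@eq_measurable_fun _ _ (borel R d) R X
    (fun x => k * char_eval a u x + char_eval a v x)) => [x|].
    by move=> /set_mem Xx; rewrite char_eval_scalar.
  by apply: measurable_funD => //; apply: measurable_funM => //; exact: measurable_cst.
- move=> /asboolP mu /asboolP mv; apply/asboolP.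
  apply: (@eq_measurable_fun _ _ (borel R d) R X
    (fun x => char_eval a u x * char_eval a v x)) => [x|].
    by move=> /set_mem Xx; rewrite char_evalM.
  exact: measurable_funM.
- apply/asboolP; apply: (@eq_measurable_fun _ _ (borel R d) R X
    (fun x : borel R d => (x : 'rV[R]_d) 0 i)) => [x|].
    by move=> /set_mem Xx; rewrite char_eval_gen.
  apply: (@measurable_funS _ _ (borel R d) R setT) => //.
  apply: (measurability _ (RGenOInfty.measurableE R)) => _ [_ [r ->] <-].
  rewrite setTI; apply: sub_sigma_algebra.
  have /continuousP := @coord_continuous R 1 d 0 i; apply.
  by rewrite set_itvE; exact: open_gt.
Qed.

End CharacterSpace.

(** * Measures carried by a closed set of characters *)

Section MomentMeasures.
Context {R : realType} {A : comAlgType R} {d : nat} (a : 'I_d -> A).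
Hypothesis a_gen : generates a.

Local Notation X := (char_space a).
Local Notation measure_on_Rd := {measure set (borel R d) -> \bar R}.

(** By inner regularity it is enough to treat compact sets disjoint from [K].
    Each of their points avoids some closed set with null complement, and
    finitely many of these complements cover. *)
Lemma radon_null_off_support (mu : measure_on_Rd) (K : set 'rV[R]_d) :
  radon_on X mu -> closed K -> support_in X mu `<=` K -> mu (X `\` K) = 0%E.
Proof.
move=> [_ _ mu_reg] K_closed suppK.
have mX := measurable_char_space a a_gen.
have mXK : measurable (X `\` K : set (borel R d)).
  by apply: measurableD => //; exact: measurable_closed.
rewrite mu_reg//.
apply/eqP; rewrite eq_le; apply/andP; split; last first.
  apply: ereal_sup_ubound; exists set0; last exact: measure0.
  by split; [exact: compact0|exact: sub0set].
apply: ge_ereal_sup => _ [C [C_compact CXK] <-].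
have sep x : exists D : set 'rV[R]_d, C x -> [/\ closed D, mu (X `\` D) = 0%E & ~ D x].
  have [Cx|nCx] := pselect (C x); last by exists set0.
  have [Xx nKx] := CXK _ Cx.
  apply: contrapT => /forallNP nD; apply: nKx; apply: suppK; split=> // D [D_cl D0].
  by apply: contrapT => nDx; apply: (nD D).
have [D CD] := choice sep.
have D_cl x : C x -> closed (D x) by move=> /CD[].
have C_cover : @cover_compact 'rV[R]_d C by rewrite -compact_cover.
have [||F FC Fcov] := C_cover 'rV[R]_d C (fun x => ~` D x).
- by move=> x Cx; exact/closed_openC/D_cl.
- by move=> x Cx; exists x => //; have [] := CD _ Cx.
have FD x : [set` F] x -> C x by move=> /FC/set_mem.
have mXD x : [set` F] x -> measurable (X `\` D x : set (borel R d)).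
  by move=> /FD Cx; apply: measurableD => //; apply: measurable_closed; exact: D_cl.
have CF : C `<=` \bigcup_(x in [set` F]) (X `\` D x).
  move=> x Cx; have [y Fy nDy] := Fcov _ Cx; exists y => //; split=> //.
  by have [] := CXK _ Cx.
have mC : measurable (C : set (borel R d)).
  by apply: measurable_closed; apply: compact_closed C_compact; exact: norm_hausdorff.
apply: (le_trans (content_sub_fsum mu (finite_fset F) mXD mC CF)).
by rewrite fsbig1// => x /FD /CD[].
Qed.

(** The growth bound is only assumed on [K]; off [K] the measure vanishes. *)
Lemma moment_measure_bound (mu : measure_on_Rd) (K : set 'rV[R]_d) n f C :
  closed K -> moment_measure a mu -> support_in X mu `<=` K ->
  (forall x, K x -> `|char_eval a f x| <= C * char_eval a (weight a ^+ n) x) ->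
  `|\int[mu]_(x in X) char_eval a f x|
    <= C * \int[mu]_(x in X) char_eval a (weight a ^+ n) x.
Proof.
move=> K_closed [mu_radon mu_int] suppK fC.
have mX := measurable_char_space a a_gen.
have mK := measurable_closed _ K_closed.
have mXK : measurable (X `\` K : set (borel R d)) by exact: measurableD.
have muXK := radon_null_off_support _ _ mu_radon K_closed suppK.
have toK g : \int[mu]_(x in X) char_eval a g x =
    \int[mu]_(x in X `&` K) char_eval a g x.
  congr fine; rewrite (@negligible_integral _ _ _ mu X (X `\` K))//.
    by rewrite setDD.
  exact: mu_int.
have int_K g : mu.-integrable (X `&` K) (EFin \o char_eval a g).
  apply: (integrableS mX) => //; first exact: measurableI.
have mXIK : measurable (X `&` K : set (borel R d)) by exact: measurableI.
rewrite !toK; apply: (le_trans (le_normr_Rintegral mXIK (int_K f))).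
rewrite -RintegralZl//; apply: le_Rintegral => // [||x [_ Kx]]; last exact: fC.
- exact: (integrable_norm (int_K f)).
- exact: (integrableZl mXIK C (int_K (weight a ^+ n))).
Qed.

End MomentMeasures.

(** * Moment functionals force finite-dimensional growth *)

Section IndependentSequences.
Context {R : realType} {V : lmodType R}.
Implicit Types (f : nat -> V) (v c : nat -> R).

(** Independence in the form in which a sequence is built greedily: no
    term is a combination of the earlier ones. *)
Definition independent_sequence f :=
  forall k, ~ exists c, f k = \sum_(i < k) c i *: f i.

Lemma independent_sequence_coef0 f c n : independent_sequence f ->
  \sum_(i < n) c i *: f i = 0 -> forall i, (i < n)%N -> c i = 0.
Proof.
move=> f_free; elim: n => // n IHn; rewrite big_ord_recr/= => sum0.
have cn0 : c n = 0.
  apply: contrapT => /eqP cn_neq0; apply: (f_free n).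
  exists (fun i => - (c n)^-1 * c i).
  under eq_bigr do rewrite -scalerA.
  have sumE : \sum_(i < n) c i *: f i = - (c n *: f n).
    by apply/eqP; rewrite -addr_eq0 sum0.
  rewrite -scaler_sumr sumE scaleNr scalerN opprK.
  by rewrite scalerA mulVf// scale1r.
move=> i; rewrite ltnS leq_eqVlt => /predU1P[-> //|]; apply: IHn.
by move: sum0; rewrite cn0 scale0r addr0.
Qed.

Lemma exists_prescribed_functional f v : independent_sequence f ->
  exists L : {scalar V}, forall k, L (f k) = v k.
Proof.
move=> f_free.
(* Requiring the two identities for all large [n] makes sums of two
   combinations of different lengths painless. *)
pose G (u : V) (x : R) := exists c N, forall n, (N <= n)%N ->
  u = \sum_(i < n) c i *: f i /\ x = \sum_(i < n) c i * v i.
have [||L LG] := @linear_extension _ _ G.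
- split.
    exists (fun=> 0), 0%N => n _.
    by split; rewrite big1// => i _; rewrite ?scale0r ?mul0r.
  move=> k u u' x x' [c [N cN]] [c' [N' cN']].
  exists (fun i => k * c i + c' i), (maxn N N') => n; rewrite geq_max => /andP[Nn N'n].
  have [-> ->] := cN _ Nn; have [-> ->] := cN' _ N'n.
  rewrite scaler_sumr mulr_sumr -!big_split/=.
  by split; apply: eq_bigr => i _; rewrite ?scalerDl ?scalerA ?mulrDl ?mulrA.
- move=> x [c [N cN]]; have [sum0 ->] := cN _ (leqnn N).
  rewrite big1// => i _.
  by rewrite (independent_sequence_coef0 _ _ _ f_free (esym sum0))// mul0r.
exists L => k; apply: LG; exists (fun i => (i == k)%:R), k.+1 => n kn.
have kn' : (k < n)%N by [].
rewrite (bigD1 (Ordinal kn'))//= (bigD1 (Ordinal kn') (F := fun i : 'I_n => _ * v i))//=.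
rewrite eqxx scale1r mul1r !big1 ?addr0// => i; rewrite -val_eqE/= => /negPf ->.
  by rewrite mul0r.
by rewrite scale0r.
Qed.

End IndependentSequences.

Section InfiniteDimension.
Context {R : realType} {A : comAlgType R}.

Lemma independent_sequence_infinite_dim (W : set A) :
  W 0 -> (forall k f g, W f -> W g -> W (k *: f + g)) ->
  ~ finite_dimensional W ->
  exists f : nat -> A, (forall k, W (f k)) /\ independent_sequence f.
Proof.
move=> W0 W_lin W_inf.
have step (s : seq A) : exists g, (forall u, u \in s -> W u) ->
    W g /\ ~ exists c : nat -> R, g = \sum_(i < size s) c i *: s`_i.
  have [sW|nsW] := pselect (forall u, u \in s -> W u); last by exists 0.
  apply: contrapT => /forallNP nstep; apply: W_inf.
  exists (size s), (fun i => s`_i); apply/seteqP; split=> [g Wg|_ [c _ <-]].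
    apply: contrapT => ng; apply: (nstep g) => _; split=> // -[c gc].
    by apply: ng; exists (fun i => c i).
  elim/big_ind: _ => // [u v Wu Wv|i _].
    by rewrite -[u]scale1r; exact: W_lin.
  by rewrite -[_ *: _]addr0; apply: W_lin => //; exact/sW/mem_nth.
have [next nextP] := choice step.
pose t n := iter n (fun s => rcons s (next s)) [::].
pose f n := next (t n).
have tE n : t n = mkseq f n by elim: n => //= n IHn; rewrite mkseqS -IHn.
have tW n u : u \in t n -> W u.
  elim: n u => //= n IHn u; rewrite mem_rcons inE => /predU1P[->|/IHn//].
  by have [] := nextP _ IHn.
exists f; split=> [k|k [c fc]]; have [Wf nf] := nextP _ (tW k) => //.
apply: nf; exists c; rewrite -/(f k) fc tE size_mkseq.
by apply: eq_bigr => i _; rewrite nth_mkseq.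
Qed.

End InfiniteDimension.

Section Necessity.
Context {R : realType} {A : comAlgType R} {d : nat} (a : 'I_d -> A).
Hypothesis a_gen : generates a.
Variable K : set 'rV[R]_d.
Hypotheses (K_closed : closed K) (KX : K `<=` char_space a).
Hypothesis all_moment : forall L : {scalar A}, general_moment_functional_on a K L.

Lemma functional_growth_bound (L : {scalar A}) n :
  exists M, forall f C,
    (forall x, K x -> `|char_eval a f x| <= C * char_eval a (weight a ^+ n) x) ->
    `|L f| <= C * M.
Proof.
have [mu1 [mu2 [mom1 mom2 supp1 supp2 LE]]] := all_moment L.
exists (\int[mu1]_(x in char_space a) char_eval a (weight a ^+ n) x
  + \int[mu2]_(x in char_space a) char_eval a (weight a ^+ n) x) => f C fC.
rewrite LE (le_trans (ler_normB _ _))// mulrDr lerD//.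
  exact: moment_measure_bound K_closed mom1 supp1 fC.
exact: moment_measure_bound K_closed mom2 supp2 fC.
Qed.

Lemma separates_points_of_all_moment : separates_points a K.
Proof.
move=> f f0; apply: contrapT => /eqP f_neq0.
pose G (u : A) (x : R) := u = x *: f.
have [||L LG] := @linear_extension _ _ G.
- split=> [|k _ _ x z -> ->]; first by rewrite /G scale0r.
  by rewrite /G scalerDl scalerA.
- by move=> x /esym/eqP; rewrite scaler_eq0 (negPf f_neq0) orbF => /eqP.
have [M LM] := functional_growth_bound L 0.
suff : `|L f| <= 0 * M by rewrite (LG f 1) /G ?scale1r// normr1 mul0r ler10.
by apply: LM => x Kx; rewrite f0// normr0 mul0r.
Qed.

Lemma finite_dim_growth_of_all_moment n : finite_dimensional (growth_space a K n).
Proof.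
apply: contrapT => /(independent_sequence_infinite_dim _ _ _).
move=> /(_ (growth_space0 a a_gen K KX n)).
move=> /(_ (growth_space_lin a a_gen K KX n)) [f [fK f_free]].
have fC k : exists C, 0 < C /\
    forall x, K x -> `|char_eval a (f k) x| <= C * char_eval a (weight a ^+ n) x.
  have [C C0 fC] := fK k; exists C; split=> // x Kx.
  by rewrite char_eval_weight// ?fC//; exact: KX.
have [C /all_and2[C0 {}fC]] := choice fC.
have [L Lf] := exists_prescribed_functional f (fun k => k%:R * C k) f_free.
have [M LM] := functional_growth_bound L n.
(* [L f_k = k C_k] would give [k <= M] for every [k]. *)
pose k := Num.bound `|M|.
have := le_trans (ler_norm _) (LM _ _ (fC k)).
rewrite Lf mulrC ler_pM2l// leNgt => /negP; apply.
by rewrite (le_lt_trans (ler_norm M))// archi_boundP.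
Qed.

End Necessity.

(** * Countable sums of point masses *)

Section AtomicMeasures.
Context {R : realType} {d : nat}.

Local Notation point := 'rV[R]_d.
Local Notation measure_on_Rd := {measure set (borel R d) -> \bar R}.
Implicit Types (s : seq ({nonneg R} * point)) (X K : set point) (f : point -> R).

(** Finite sums of point masses, as lists of weighted points: repetitions
    are allowed and the weights add up. *)
Fixpoint atomic s : measure_on_Rd :=
  if s is p :: s' then
    measure_add (mscale p.1 (dirac (p.2 : borel R d))) (atomic s')
  else mzero.

Lemma atomicE s (B : set (borel R d)) :
  atomic s B = (\sum_(p <- s) p.1%:num * \1_B p.2)%:E.
Proof.
elim: s => [|p s IHs]; first by rewrite big_nil.
rewrite big_cons EFinD -IHs.
exact: (measure_addE (mscale p.1 (dirac (p.2 : borel R d))) (atomic s) B).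
Qed.

Lemma atomic_null s (B : set point) :
  (forall p, p \in s -> ~ B p.2) -> atomic s B = 0%E.
Proof.
move=> sB; rewrite atomicE big_seq big1// => p /sB nBp.
by rewrite indicE memNset// mulr0.
Qed.

Lemma ge0_integral_atomic s X (f : point -> \bar R) :
  measurable (X : set (borel R d)) -> measurable_fun (X : set (borel R d)) f ->
  (forall x, X x -> 0 <= f x)%E -> (forall p, p \in s -> X p.2) ->
  (\int[atomic s]_(x in X) f x = \sum_(p <- s) p.1%:num%:E * f p.2)%E.
Proof.
move=> mX mf f0; elim: s => [_|p s IHs sX].
  by rewrite big_nil integral_measure_zero.
rewrite big_cons /= ge0_integral_measure_add// IHs => [|q qs]; last first.
  by apply: sX; rewrite inE qs orbT.
rewrite ge0_integral_mscale// integral_dirac// diracE mem_set ?mul1e//.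
by apply: sX; rewrite inE eqxx.
Qed.

Lemma eseries_EFin (u : nat -> R) : cvgn (series u) ->
  (\sum_(0 <= n <oo) (u n)%:E = (limn (series u))%:E)%E.
Proof.
move=> u_cvg; rewrite -EFin_lim//; congr (limn _).
by apply/funext => n; rewrite /series/= sumEFin.
Qed.

Section AtomicSeries.
Variables (s_ : nat -> seq ({nonneg R} * point)) (X K : set point).
Hypotheses (X_closed : closed X) (s_K : forall n p, p \in s_ n -> K p.2).
Hypothesis KX : K `<=` X.

Local Notation mu := (mseries (fun n => atomic (s_ n)) 0).

Let mX : measurable (X : set (borel R d)) := measurable_closed _ X_closed.
Let s_X n p : p \in s_ n -> X p.2. Proof. by move=> /s_K /KX. Qed.

Lemma atomic_series_null (B : set point) : B `&` K = set0 -> mu B = 0%E.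
Proof.
move=> BK; rewrite /mseries eseries0// => n _ _.
apply: atomic_null => p /s_K Kp Bp.
by have : (B `&` K) p.2 by []; rewrite BK.
Qed.

Lemma support_atomic_series (C : set point) :
  closed C -> K = X `&` C -> support_in X mu `<=` K.
Proof.
move=> C_closed KE x [Xx suppx]; rewrite KE; split=> //; apply: suppx.
split=> //; apply: atomic_series_null.
by rewrite KE; apply/seteqP; split=> // y [[_ nCy] [_ Cy]].
Qed.

(** Inner regularity holds because the mass of [B] is exhausted by the finite
    sets of atoms of [B] occurring in the first [N] blocks. *)
Lemma radon_atomic_series :
  cvgn (series (fun n => \sum_(p <- s_ n) p.1%:num)) -> radon_on X mu.
Proof.
move=> mass_cvg; have mu_fin : (mu setT < +oo)%E.
  rewrite /mseries (eq_eseriesr (g := fun n => (\sum_(p <- s_ n) p.1%:num)%:E)).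
    by rewrite eseries_EFin// ltry.
  move=> n _; rewrite atomicE; congr EFin; apply: eq_bigr => p _.
  by rewrite indicT mulr1.
split.
- by apply: atomic_series_null; apply/seteqP; split=> // x [nXx /KX].
- move=> C C_compact _; apply: le_lt_trans mu_fin.
  by apply: le_measure => //; rewrite inE//;
    apply: measurable_closed; apply: compact_closed C_compact; exact: norm_hausdorff.
move=> B mB BX; apply/eqP; rewrite eq_le; apply/andP; split; last first.
  apply: ge_ereal_sup => _ [C [C_compact CB] <-].
  apply: le_measure => //; rewrite inE//.
  by apply: measurable_closed; apply: compact_closed C_compact; exact: norm_hausdorff.
rewrite {1}/mseries; apply: lime_le; first by apply: is_cvg_nneseries.
apply: nearW => N; pose F := B `&` [set x | exists2 n, (n < N)%N & x \in unzip2 (s_ n)].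
have F_fin : finite_set F.
  apply: (@sub_finite_set _ _ [set` flatten [seq unzip2 (s_ n) | n <- iota 0 N]]).
    move=> x [_ [n nN xn]]; apply/flattenP; exists (unzip2 (s_ n)) => //.
    by apply: map_f; rewrite mem_iota.
  exact: finite_seq.
have F_compact : compact (F : set 'rV[R]_d) by exact: finite_compact.
have mF : measurable (F : set (borel R d)).
  by apply: measurable_closed; apply: compact_closed F_compact; exact: norm_hausdorff.
apply: (@le_trans _ _ (mu F)); last first.
  by apply: ereal_sup_ubound; exists F => //; split=> // x [].
apply: (@le_trans _ _ (\sum_(0 <= n < N) atomic (s_ n) F)%E); last first.
  exact: (nneseries_lim_ge (u_ := fun n => atomic (s_ n) F)).
rewrite !big_mkord; apply: lee_sum => n _; rewrite !atomicE lee_fin le_eqVlt.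
apply/orP; left; apply/eqP; apply: eq_big_seq => p pn.
congr (_ * _); rewrite !indicE; congr (_%:R); congr nat_of_bool.
apply/idP/idP => /set_mem Bp; apply/mem_set; last by case: Bp.
by split=> //; exists n => //; exact: map_f.
Qed.

Section Integration.
Variable f : point -> R.
Hypothesis mf : measurable_fun (X : set (borel R d)) f.
Hypothesis f_summable : (cvgn (series (fun n => \sum_(p <- s_ n) p.1%:num * `|f p.2|))).

Let mEf : measurable_fun (X : set (borel R d)) (EFin \o f).
Proof. exact/measurable_EFinP. Qed.

Lemma integral_atomic s : (forall p, p \in s -> X p.2) ->
  (\int[atomic s]_(x in X) (f x)%:E = (\sum_(p <- s) p.1%:num * f p.2)%:E)%E.
Proof.
move=> sX; rewrite integralE !ge0_integral_atomic//; last 2 first.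
- exact: measurable_funeneg.
- exact: measurable_funepos.
rewrite -sumEFin.
have EM c r : (c%:E * r%:E = (c * r)%:E :> \bar R)%E by [].
under eq_bigr do rewrite funeposE -EFin_max EM.
under [X in (_ - X)%E]eq_bigr do rewrite funenegE -EFinN -EFin_max EM.
rewrite !sumEFin -EFinB -sumrB; congr EFin; apply: eq_bigr => p _.
rewrite -mulrBr; congr (_ * _); have [f0|f0] := leP 0 (f p.2).
  by rewrite max_r ?subr0// oppr_le0.
by rewrite max_l ?sub0r ?opprK// oppr_ge0 ltW.
Qed.

Lemma integrable_atomic_series : mu.-integrable X (EFin \o f).
Proof.
apply/integrableP; split=> //.
rewrite ge0_integral_measure_series//; last exact: measurableT_comp.
under eq_eseriesr => n _.
  rewrite ge0_integral_atomic//; [|exact: measurableT_comp|by move=> p; exact: s_X].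
  rewrite (eq_bigr (fun p => (p.1%:num * `|f p.2|)%:E))// sumEFin.
  over.
by rewrite eseries_EFin// ltry.
Qed.

(** The integral is stated as a limit of block sums, so that those of the
    positive and negative masses can be subtracted term by term. *)
Lemma cvg_series_atomic :
  series (fun n => \sum_(p <- s_ n) p.1%:num * f p.2) @ \oo
    --> \int[mu]_(x in X) f x.
Proof.
have intE n : (\int[atomic (s_ n)]_(x in X) (f x)%:E =
    (\sum_(p <- s_ n) p.1%:num * f p.2)%:E)%E.
  by apply: integral_atomic => p; exact: s_X.
have int_abs n : (\int[atomic (s_ n)]_(x in X) `|(f x)%:E| =
    (\sum_(p <- s_ n) p.1%:num * `|f p.2|)%:E)%E.
  rewrite ge0_integral_atomic//; [|exact: measurableT_comp|by move=> p; exact: s_X].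
  by rewrite (eq_bigr (fun p => (p.1%:num * `|f p.2|)%:E))// sumEFin.
have u_cvg : cvgn (series (fun n => \sum_(p <- s_ n) p.1%:num * f p.2)).
  apply: normed_cvg; apply: series_le_cvg f_summable => [n|n|n] //=.
    by rewrite sumr_ge0// => p _; rewrite mulr_ge0.
  rewrite (le_trans (ler_norm_sum _ _ _))//; apply: ler_sum => p _.
  by rewrite normrM ger0_norm.
have absE x : (`|(f x)%:E| = (EFin \o f)^\+ x + (EFin \o f)^\- x)%E.
  by rewrite -[LHS]/((abse \o (EFin \o f)) x) fune_abse.
have part_lty (g : point -> \bar R) : measurable_fun (X : set (borel R d)) g ->
    (forall x, 0 <= g x)%E -> (forall x, g x <= `|(f x)%:E|)%E ->
    (\sum_(n <oo) `|\int[atomic (s_ n)]_(x in X) g x| < +oo)%E.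
  move=> mg g0 gf; rewrite (@le_lt_trans _ _
    (\sum_(0 <= n <oo) (\sum_(p <- s_ n) p.1%:num * `|f p.2|)%:E)%E)//; last first.
    by rewrite eseries_EFin// ltry.
  apply: lee_nneseries => // n _; rewrite gee0_abs; last exact: integral_ge0.
  rewrite -int_abs; apply: ge0_le_integral => //.
  exact: measurableT_comp.
rewrite (_ : \int[mu]_(x in X) f x = limn (series (fun n => \sum_(p <- s_ n) p.1%:num * f p.2)))//.
rewrite /Rintegral integral_measure_series//.
- by under eq_eseriesr do rewrite intE; rewrite eseries_EFin.
- move=> n; apply/integrableP; split; first exact: mEf.
  by rewrite int_abs ltry.
- apply: part_lty => //; first exact: measurable_funeneg.
  by move=> x; rewrite absE leeDr.
- apply: part_lty => //; first exact: measurable_funepos.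
  by move=> x; rewrite absE leeDl.
Qed.

End Integration.
End AtomicSeries.
End AtomicMeasures.

(** * Finite-dimensional growth gives representing measures *)

Section PositivePart.
Context {R : realType}.

Lemma max0_ge0 (c : R) : 0 <= Num.max c 0.
Proof. by rewrite le_max lexx orbT. Qed.

Definition pos_part (c : R) : {nonneg R} := NngNum (max0_ge0 c).

Lemma pos_partB c : (pos_part c)%:num - (pos_part (- c))%:num = c.
Proof.
rewrite /=; have [c0|c0] := leP 0 c; first by rewrite max_r ?subr0// oppr_le0.
by rewrite max_l ?sub0r ?opprK// oppr_ge0 ltW.
Qed.

Lemma pos_part_le c : (pos_part c)%:num <= `|c|.
Proof. by rewrite /= ge_max ler_norm normr_ge0. Qed.

End PositivePart.

Section Sufficiency.
Context {R : realType} {A : comAlgType R} {d : nat} (a : 'I_d -> A).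
Hypothesis a_gen : generates a.
Variables (K C : set 'rV[R]_d).
Hypotheses (C_closed : closed C) (KE : K = char_space a `&` C).
Hypothesis K_sep : separates_points a K.
Hypothesis growth_fin : forall n, finite_dimensional (growth_space a K n).
Variable L : {scalar A}.

Local Notation X := (char_space a).
Local Notation point := 'rV[R]_d.
Local Notation ev := (char_eval a).

Let KX : K `<=` X. Proof. by rewrite KE => x []. Qed.

(** The weight against which block [n] has to be small: [p^(n-1)], and [0] for the
    first block, where by separation only the zero element is bounded by the weight. *)
Definition previous_weight n (x : point) : R :=
  if n is m.+1 then ev (weight a ^+ m) x else 0.

(** One step of the construction: the error of the masses [t] vanishes on the
    elements bounded by the previous weight, which is the hypothesis of
    [small_atomic_representation], and [s] removes this error on all of [N_n]. *)
Lemma growth_correction n (t : seq (R * point)) : (forall p, p \in t -> K p.2) ->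
  (forall f, (forall x, K x -> `|ev f x| <= previous_weight n x) ->
     \sum_(p <- t) p.1 * ev f p.2 = L f) ->
  exists s : seq (R * point),
    [/\ forall p, p \in s -> K p.2,
        forall f, growth_space a K n f ->
          \sum_(p <- t ++ s) p.1 * ev f p.2 = L f
      & \sum_(p <- s) `|p.1| * previous_weight n p.2 <= 2^-1 ^+ n].
Proof.
move=> tK tL; have [m [b bE]] := growth_fin n.
pose l f := L f - \sum_(p <- t) p.1 * ev f p.2.
have l_lin : scalar l.
  move=> k f g; rewrite /l scalarP.
  have -> : \sum_(p <- t) p.1 * ev (k *: f + g) p.2 =
      k * (\sum_(p <- t) p.1 * ev f p.2) + \sum_(p <- t) p.1 * ev g p.2.
    rewrite mulr_sumr -big_split/=; apply: eq_big_seq => p /tK /KX Xp.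
    by rewrite char_eval_scalar// mulrDr mulrCA.
  by ring.
have w0 x : K x -> 0 <= previous_weight n x.
  case: n {tL bE} => //= n /KX Xx.
  exact/(le_trans ler01)/char_eval_weight_ge1.
have [||c f fw|s [sK sl sw]] := @small_atomic_representation _ _ _ K
  (fun x f => ev f x) m b (previous_weight n) l (2^-1 ^+ n) _ l_lin w0.
- by move=> x /KX; exact: char_eval_scalar.
- by rewrite exprn_gt0// invr_gt0 ltr0n.
- by rewrite /l tL// subrr.
exists s; split=> // f; rewrite bE => -[c _ <-].
by rewrite big_cat/= sl /l addrC subrK.
Qed.

Lemma atomic_blocks : exists s : nat -> seq (R * point),
  [/\ forall n p, p \in s n -> K p.2,
      forall n f, growth_space a K n f ->
        \sum_(j < n.+1) \sum_(p <- s j) p.1 * ev f p.2 = L f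
    & forall n, \sum_(p <- s n.+1) `|p.1| * ev (weight a ^+ n) p.2 <= 2^-1 ^+ n.+1].
Proof.
pose good n (t : seq (R * point)) := (forall p, p \in t -> K p.2) /\
  (forall f, (forall x, K x -> `|ev f x| <= previous_weight n x) ->
     \sum_(p <- t) p.1 * ev f p.2 = L f).
have step (nt : nat * seq (R * point)) : exists s : seq (R * point),
    good nt.1 nt.2 ->
    [/\ forall p, p \in s -> K p.2,
        forall f, growth_space a K nt.1 f ->
          \sum_(p <- nt.2 ++ s) p.1 * ev f p.2 = L f
      & \sum_(p <- s) `|p.1| * previous_weight nt.1 p.2 <= 2^-1 ^+ nt.1].
  have [[tK tL]|ng] := pselect (good nt.1 nt.2); last by exists [::].
  by have [s sP] := growth_correction _ _ tK tL; exists s.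
have [next nextP] := choice step.
pose fix t n := if n is m.+1 then t m ++ next (m, t m) else [::].
have t_good n : good n (t n).
  elim: n => [|n IHn]; first split=> //= f f0.
    rewrite big_nil (_ : f = 0) ?raddf0//; apply: K_sep => x /f0.
    by rewrite normr_le0 => /eqP.
  have [sK sL _] := nextP (n, t n) IHn; have [tK _] := IHn; split=> [p|f fw].
    by rewrite mem_cat => /orP[/tK|/sK].
  by apply: sL; apply/(growth_spaceP _ a_gen _ KX); exists 1 => x Kx; rewrite mul1r fw.
have tE n f : \sum_(p <- t n) p.1 * ev f p.2 =
    \sum_(j < n) \sum_(p <- next (j : nat, t j)) p.1 * ev f p.2.
  elim: n => [|n IHn]; first by rewrite big_nil big_ord0.
  by rewrite big_ord_recr/= -IHn big_cat.
exists (fun n => next (n, t n)); split=> [n|n f fn|n].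
- by have [] := nextP (n, t n) (t_good n).
- by rewrite -tE; have [_ + _] := nextP (n, t n) (t_good n); exact.
- by have [] := nextP (n.+1, t n.+1) (t_good n.+1).
Qed.

(** For [n >= m], an element of [N_m] is bounded by [D p^m <= D p^n] on [K], and
    block [n+1] has mass at most [2^-(n+1)] against [p^n].  The finitely
    many earlier blocks are absorbed in the constant [E], which turns the
    estimate into a geometric bound valid for all blocks. *)
Lemma atomic_blocks_summable (s : nat -> seq (R * point)) :
  (forall n p, p \in s n -> K p.2) ->
  (forall n, \sum_(p <- s n.+1) `|p.1| * ev (weight a ^+ n) p.2 <= 2^-1 ^+ n.+1) ->
  forall f, cvgn (series (fun n => \sum_(p <- s n) `|p.1| * `|ev f p.2|)).
Proof.
move=> sK s_small f; have [m [D D0 fD]] := growth_space_exhaust a a_gen K KX f.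
pose u n := \sum_(p <- s n) `|p.1| * `|ev f p.2|.
have u0 n : 0 <= u n by apply: sumr_ge0 => p _; rewrite mulr_ge0.
pose E := \sum_(k < m.+1) u k * 2 ^+ k + D.
have D_E : D <= E.
  by rewrite lerDr sumr_ge0// => k _; rewrite mulr_ge0// exprn_ge0.
have half0 n : 0 <= (2^-1 : R) ^+ n by rewrite exprn_ge0// invr_ge0 ler0n.
apply: (@series_le_cvg _ u (geometric E 2^-1)) => // [n|n|].
- by rewrite /= mulr_ge0// (le_trans (ltW D0)).
- rewrite /=; have [nm|mn] := ltnP n m.+1.
    have -> : u n = u n * 2 ^+ n * 2^-1 ^+ n.
      by rewrite -mulrA -exprMn divff ?expr1n ?mulr1// pnatr_eq0.
    rewrite ler_wpM2r// /E (bigD1 (Ordinal nm))//= -addrA lerDl.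
    by rewrite addr_ge0 ?(ltW D0)// sumr_ge0// => k _; rewrite mulr_ge0// exprn_ge0.
  case: n mn => // n mn.
  apply: (@le_trans _ _ (D * 2^-1 ^+ n.+1)); last by rewrite ler_wpM2r.
  apply: le_trans (ler_wpM2l (ltW D0) (s_small n)).
  rewrite mulr_sumr /u big_seq [leRHS]big_seq; apply: ler_sum => p /sK Kp.
  rewrite mulrCA ler_wpM2l//; apply: (le_trans (fD _ Kp)).
  rewrite -char_eval_weight//; last exact: KX.
  rewrite ler_pM2l//; apply: char_eval_weight_mono => //; exact: KX.
- by apply: is_cvg_geometric_series; rewrite ger0_norm ?invr_ge0// invf_lt1// ltr1n.
Qed.

Definition weighted_points (w : R -> {nonneg R}) (s : seq (R * point)) :=
  [seq (w p.1, p.2) | p <- s].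

(** Used twice, with [w] the positive and the negative part of the masses. *)
Lemma moment_measure_blocks (s : nat -> seq (R * point)) (w : R -> {nonneg R}) :
  (forall n p, p \in s n -> K p.2) ->
  (forall f, cvgn (series (fun n => \sum_(p <- s n) `|p.1| * `|ev f p.2|))) ->
  (forall c, (w c)%:num <= `|c|) ->
  let mu := mseries (fun n => atomic (weighted_points w (s n))) 0 in
  [/\ moment_measure a mu, support_in X mu `<=` K
    & forall f, series (fun n => \sum_(p <- s n) (w p.1)%:num * ev f p.2) @ \oo
        --> \int[mu]_(x in X) ev f x].
Proof.
move=> sK s_cvg w_le mu.
have X_closed := closed_char_space a_gen.
have wK n p : p \in weighted_points w (s n) -> K p.2.
  by move=> /mapP[q /sK Kq ->].
have w_cvg f : cvgn (series (fun n =>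
    \sum_(p <- weighted_points w (s n)) p.1%:num * `|ev f p.2|)).
  apply: series_le_cvg (s_cvg f) => n /=.
  - by apply: sumr_ge0 => p _; rewrite mulr_ge0.
  - by apply: sumr_ge0 => p _; rewrite mulr_ge0.
  - by rewrite big_map; apply: ler_sum => p _ /=; rewrite ler_wpM2r.
split.
- split=> [|f]; last first.
    apply: (integrable_atomic_series _ _ _ X_closed wK KX) => //.
    exact: measurable_char_eval.
  apply: (radon_atomic_series _ _ _ wK KX).
  rewrite (_ : (fun n => _) = fun n =>
    \sum_(p <- weighted_points w (s n)) p.1%:num * `|ev 1 p.2|)//.
  apply/funext => n; apply: eq_big_seq => p /wK /KX Xp.
  by rewrite char_eval1// normr1 mulr1.
- exact: (support_atomic_series _ _ _ wK _ C_closed KE).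
- move=> f; have := cvg_series_atomic _ _ _ X_closed wK KX _
    (measurable_char_eval a a_gen f) (w_cvg f).
  by under [X in series X]eq_fun do rewrite big_map.
Qed.

Lemma general_moment_functional_of_finite_growth : general_moment_functional_on a K L.
Proof.
have [s [sK sL s_small]] := atomic_blocks.
have s_cvg := atomic_blocks_summable _ sK s_small.
have [|mom1 supp1 int1] := moment_measure_blocks _ pos_part sK s_cvg.
  exact: pos_part_le.
have [|mom2 supp2 int2] := moment_measure_blocks _ (fun c => pos_part (- c)) sK s_cvg.
  by move=> c; rewrite (le_trans (pos_part_le _))// normrN.
eexists; eexists; split; [exact: mom1|exact: mom2|exact: supp1|exact: supp2|] => f.
have [m fm] := growth_space_exhaust a a_gen K KX f.
apply/esym; apply: (cvg_unique _ (cvgB (int1 f) (int2 f))) => //.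
apply: cvg_near_cst; exists m.+1 => // n /= mn.
rewrite /series !fctE -sumrB.
rewrite (eq_bigr (fun j => \sum_(p <- s j) p.1 * ev f p.2)); last first.
  move=> j _; rewrite -sumrB; apply: eq_bigr => p _.
  by rewrite -mulrBl pos_partB.
case: n mn => // n mn; rewrite big_mkord; apply: sL.
exact: growth_space_mono fm.
Qed.

End Sufficiency.

Theorem theorem2 (R : realType) (A : comAlgType R) (d : nat) (a : 'I_d -> A)
    (a_gen : generates a) (K : set 'rV[R]_d)
    (K_closed : exists2 C : set 'rV[R]_d, closed C & K = char_space a `&` C) :
  (forall L : {scalar A}, general_moment_functional_on a K L)
  <->
  (separates_points a K /\
   forall n : nat, finite_dimensional (growth_space a K n)).
Proof.
have [C C_closed KE] := K_closed.
split=> [all_moment|[K_sep growth_fin] L]; last first.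
  exact: general_moment_functional_of_finite_growth C_closed KE K_sep growth_fin L.
have KX : K `<=` char_space a by rewrite KE => x [].
have clK : closed K by rewrite KE; apply: closedI => //; exact: closed_char_space.
split=> [|n]; first exact: separates_points_of_all_moment clK all_moment.
exact: finite_dim_growth_of_all_moment clK KX all_moment n.
Qed.
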